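(* Let $q$ be an odd prime power, $N,Q_0\in\mathbb{N}$, $\Delta:=q^{-N}$, and let $\mathcal{S}$ be a set of nonzero polynomials in $\mathbb{F}_q[t]$ of degree at most $Q_0$. For nonzero $h\in\mathbb{F}_q[t]$ put $\mathcal{S}_h:=\{x\in\mathbb{F}_q[t]: hx\in\mathcal{S}\}$, and for integers $m$, nonzero $k\in\mathbb{F}_q[t]$ and $l\in\mathbb{F}_q[t]$ put \[ A_h(m;k,l):=\max_{\substack{y\in\mathbb{F}_q(t)_\infty\\ |y|_\infty\le q^{Q_0-\deg h}}}\#\big\{x\in\mathcal{S}_h:\ |x-y|_\infty\le q^m,\ x\equiv l\bmod k\big\}. \] Let $X\ge1$ and suppose that \[ A_h(m;k,l)\le\Big(1+\frac{|\mathcal{S}_h|/|k|_\infty}{q^{Q_0}/|h|_\infty}\cdot q^m\Big)X \] for all nonzero $h\in\mathbb{F}_q[t]$, all integers $m$ with $0\le m\le Q_0-\deg h$, all nonzero $k\in\mathbb{F}_q[t]$ with $|k|_\infty\le\Delta^{-1/2}$, and all $l\in\mathbb{F}_q[t]$ with $\gcd(k,l)=1$. Then for all $a_g\in\mathbb{C}$, \[ \sum_{f\in\mathcal{S}}\ \sum_{\substack{r\bmod f\\ (r,f)=1}}\Bigg|\sum_{\substack{g\in\mathbb{F}_q[t]\\ \deg g\le N}}a_g\,e\Big(g\cdot\frac rf\Big)\Bigg|^2\ \le\ C_q\Big(q^N+q^{Q_0}X\,2^{N/2}\big(q^{N/2}+|\mathcal{S}|\big)\Big)\sum_{\substack{g\in\mathbb{F}_q[t]\\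 \deg g\le N}}|a_g|^2, \] with $C_q$ depending only on $q$.
   Context: $\mathbb{F}_q(t)_\infty=\mathbb{F}_q((1/t))$ with $|\sum_{i\le n}a_it^i|_\infty=q^n$ if $a_n\ne0$, $|0|_\infty=0$. The character $e$ is $e(\sum_{i\le n}a_it^i)=\exp(\tfrac{2\pi i}{p}\mathrm{Tr}(a_{-1}))$, $p=\mathrm{char}\,\mathbb{F}_q$, $\mathrm{Tr}:\mathbb{F}_q\to\mathbb{F}_p$ the trace; it is trivial on $\mathbb{F}_q[t]$. The sum over $r$ runs over residue classes modulo $f$ coprime to $f$. *)

(* Defs.v *)
From HB Require Import structures.
From mathcomp Require Import all_boot all_order all_algebra all_field.
From mathcomp Require Import finmap.
From mathcomp Require Import mathcomp_extra boolp classical_sets functions.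
From mathcomp Require Import cardinality fsbigop reals exp trigo.
From mathcomp Require Import complex.
From mathcomp Require Import zify.

Set Implicit Arguments.
Unset Strict Implicit.
Unset Printing Implicit Defensive.

Import Order.TTheory GRing.Theory Num.Theory.

Local Open Scope classical_set_scope.
Local Open Scope ring_scope.

Section Laurent.
Variable F : fieldType.

Definition bounded_by (a : int -> F) (n : int) := forall i, n < i -> a i = 0.

(* F((1/t)): the coefficient of t^i is x i, and only finitely many positive
   powers of t occur. *)
Record laurent := Laurent {
  lcoef :> int -> F;
  lcoef_bounded : exists n, bounded_by lcoef n }.

HB.instance Definition _ := gen_eqMixin laurent.
HB.instance Definition _ := gen_choiceMixin laurent.

Lemma laurentP (x y : laurent) : (forall i, x i = y i) -> x = y.
Proof.
case: x y => [a ha] [b hb] /= /funext eq_ab.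
by subst b; congr Laurent; apply: Prop_irrelevance.
Qed.

Lemma bounded_by_le (a : int -> F) m n :
  m <= n -> bounded_by a m -> bounded_by a n.
Proof. by move=> mn am i /(le_lt_trans mn); apply: am. Qed.

Fact lzero_bounded : exists n, bounded_by (fun=> 0) n.
Proof. by exists 0. Qed.
Definition lzero := Laurent lzero_bounded.

Fact lopp_bounded (x : laurent) : exists n, bounded_by (fun i => - x i) n.
Proof. by have [n xn] := lcoef_bounded x; exists n => i /xn ->; rewrite oppr0. Qed.
Definition lopp x := Laurent (lopp_bounded x).

Fact ladd_bounded (x y : laurent) : exists n, bounded_by (fun i => x i + y i) n.
Proof.
have [[m xm] [n yn]] := (lcoef_bounded x, lcoef_bounded y).
exists (Num.max m n) => i; rewrite gt_max => /andP[/xm -> /yn ->].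
by rewrite addr0.
Qed.
Definition ladd x y := Laurent (ladd_bounded x y).

Fact laddA : associative ladd.
Proof. by move=> x y z; apply: laurentP => i /=; rewrite addrA. Qed.
Fact laddC : commutative ladd.
Proof. by move=> x y; apply: laurentP => i /=; rewrite addrC. Qed.
Fact ladd0 : left_id lzero ladd.
Proof. by move=> x; apply: laurentP => i /=; rewrite add0r. Qed.
Fact laddN : left_inverse lzero lopp ladd.
Proof. by move=> x; apply: laurentP => i /=; rewrite addNr. Qed.

HB.instance Definition _ := GRing.isZmodule.Build laurent laddA laddC ladd0 laddN.

(* The sum is over all of Z, but only finitely many terms are nonzero. *)
Definition lmul_coef (a b : int -> F) (k : int) : F :=
  \sum_(i \in [set: int]) a i * b (k - i).

Lemma lmul_coef_gt (a b : int -> F) m n : bounded_by a m -> bounded_by b n ->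
  bounded_by (lmul_coef a b) (m + n).
Proof.
move=> am bn k mnk; apply: fsbig1 => i _.
case: (ltP m i) => [/am ->|im]; first by rewrite mul0r.
by rewrite (bn (k - i)) ?mulr0 //; lia.
Qed.

Definition ltrunc (a : int -> F) (m : int) (k : nat) : {poly F} :=
  \poly_(i < k.+1) a (m - i%:Z).

Lemma lmul_coefE (a b : int -> F) m n (k : nat) :
  bounded_by a m -> bounded_by b n ->
  lmul_coef a b (m + n - k%:Z) = \sum_(i < k.+1) a (m - i%:Z) * b (n - (k - i)%N%:Z).
Proof.
move=> am bn.
pose r := [seq m - i%:Z | i <- iota 0 k.+1].
have ur : uniq r by rewrite map_inj_uniq ?iota_uniq // => i j; lia.
rewrite /lmul_coef -(fsbig_widen [set` r] [set: int]) //; last first.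
  move=> i [_ /=] /negP ir.
  case: (ltP m i) => [/am ->|im]; first by rewrite mul0r.
  rewrite (bn (m + n - k%:Z - i)) ?mulr0 //.
  rewrite ltNge; apply: contra ir => le_n.
  apply/mapP; exists (absz (m - i)%R); last by lia.
  by rewrite mem_iota; lia.
rewrite -fsbig_seq // big_map -(subn0 k.+1) -/(index_iota 0 _) big_mkord subn0.
by apply: eq_bigr => i _; congr (_ * b _); have := ltn_ord i; lia.
Qed.

Lemma coef_ltruncM (a b : int -> F) m n (k k' : nat) :
  bounded_by a m -> bounded_by b n -> (k <= k')%N ->
  lmul_coef a b (m + n - k%:Z) = (ltrunc a m k' * ltrunc b n k')`_k.
Proof.
move=> am bn kk'; rewrite lmul_coefE // coefM; apply: eq_bigr => i _.
have ik := ltn_ord i; rewrite !coef_poly.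
by rewrite !ifT //; lia.
Qed.

Fact lmul_bounded (x y : laurent) : exists n, bounded_by (lmul_coef x y) n.
Proof.
have [[m xm] [n yn]] := (lcoef_bounded x, lcoef_bounded y).
by exists (m + n); apply: lmul_coef_gt.
Qed.
Definition lmul (x y : laurent) := Laurent (lmul_bounded x y).

Fact lone_bounded : exists n, bounded_by (fun i : int => (i == 0)%:R) n.
Proof. by exists 0 => i i0; rewrite gt_eqF. Qed.
Definition lone := Laurent lone_bounded.

Fact lmulC : commutative lmul.
Proof.
move=> x y; apply: laurentP => j /=.
have [[m xm] [n yn]] := (lcoef_bounded x, lcoef_bounded y).
case: (ltP (m + n) j) => [mnj|jmn].
  by rewrite (lmul_coef_gt xm yn) // (lmul_coef_gt yn xm) // addrC.
have [k ->] : exists k : nat, j = m + n - k%:Z.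
  by exists (absz (m + n - j)%R); lia.
rewrite (coef_ltruncM xm yn (leqnn _)) mulrC.
by rewrite (addrC m) (coef_ltruncM yn xm (leqnn _)).
Qed.

Lemma lmulA_aux (x y z : laurent) m n p (k : nat) :
  bounded_by x m -> bounded_by y n -> bounded_by z p ->
  lmul x (lmul y z) (m + n + p - k%:Z)
  = (ltrunc x m k * (ltrunc y n k * ltrunc z p k))`_k.
Proof.
move=> xm yn zp; rewrite -(addrA m) /=.
rewrite lmul_coefE //; last exact: lmul_coef_gt.
rewrite coefM; apply: eq_bigr => i _; have ik := ltn_ord i.
by rewrite (@coef_ltruncM _ _ _ _ _ k yn zp) ?leq_subr // coef_poly ifT.
Qed.

Fact lmulA : associative lmul.
Proof.
move=> x y z; apply: laurentP => j.
have [m xm] := lcoef_bounded x; have [n yn] := lcoef_bounded y.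
have [p zp] := lcoef_bounded z.
have [xy yz] := (lmul_coef_gt xm yn, lmul_coef_gt yn zp).
case: (ltP (m + n + p) j) => [mnj|jmn].
  by rewrite /= (lmul_coef_gt xm yz) ?addrA // (lmul_coef_gt xy zp).
rewrite [RHS](_ : _ = lmul z (lmul x y) j); last by rewrite [in RHS]lmulC.
have [k ->] : exists k : nat, j = m + n + p - k%:Z.
  by exists (absz (m + n + p - j)%R); lia.
rewrite lmulA_aux // (_ : m + n + p = p + m + n); last by rewrite addrC addrA.
by rewrite lmulA_aux // mulrA mulrC.
Qed.

Fact lmul1 : left_id lone lmul.
Proof.
move=> x; apply: laurentP => j /=.
rewrite /lmul_coef -(fsbig_widen [set 0 : int] [set: int]) //; last first.
  by move=> i [_ /= /eqP/negPf ->]; rewrite mul0r.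
by rewrite fsbig_set1 eqxx mul1r subr0.
Qed.

Fact lmulDl : left_distributive lmul ladd.
Proof.
move=> x y z; apply: laurentP => j.
have [m xm] := lcoef_bounded x; have [n yn] := lcoef_bounded y.
have [p zp] := lcoef_bounded z.
pose M := Num.max m n.
have {}xm : bounded_by x M by apply: bounded_by_le xm; rewrite le_max lexx.
have {}yn : bounded_by y M by apply: bounded_by_le yn; rewrite le_max lexx orbT.
have xy : bounded_by (ladd x y) M by move=> i Mi /=; rewrite xm // yn // addr0.
rewrite /=; case: (ltP (M + p) j) => [Mj|jM].
  by rewrite (lmul_coef_gt xy zp) // (lmul_coef_gt xm zp) //
    (lmul_coef_gt yn zp) // addr0.
have [k ->] : exists k : nat, j = M + p - k%:Z.
  by exists (absz (M + p - j)%R); lia.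
by rewrite !lmul_coefE // -big_split; apply: eq_bigr => i _; rewrite /= mulrDl.
Qed.

Fact lone_neq0 : lone != 0.
Proof.
apply/eqP => /(congr1 (fun x : laurent => x 0)) /= /eqP.
by rewrite oner_eq0.
Qed.

HB.instance Definition _ := GRing.Zmodule_isComNzRing.Build laurent
  lmulA lmulC lmul1 lmulDl lone_neq0.

Definition is_ldeg (x : laurent) (n : int) := x n != 0 /\ bounded_by x n.

Lemma is_ldeg_uniq x m n : is_ldeg x m -> is_ldeg x n -> m = n.
Proof.
move=> [xm0 xm] [xn0 xn]; apply/eqP; rewrite eq_le !leNgt.
by apply/andP; split; apply/negP; [move/xn|move/xm] => /eqP; apply/negP.
Qed.

Lemma is_ldeg_ex x : x != 0 -> exists n, is_ldeg x n.
Proof.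
move=> x0; have [m xm] := lcoef_bounded x.
have [i xi] : exists i, x i != 0.
  apply: contrapT => nx; move/eqP: x0; apply; apply: laurentP => i /=.
  by apply/eqP/negP => /negP xi; apply: nx; exists i.
have im : i <= m by rewrite leNgt; apply/negP => /xm /eqP; apply/negP.
have ex : exists k : nat, x (m - k%:Z) != 0.
  by exists (absz (m - i)%R); have -> : m - (absz (m - i)%R)%:Z = i by lia.
case: (ex_minnP ex) => k xk kmin; exists (m - k%:Z); split=> // j kj.
case: (ltP m j) => [/xm//|jm]; apply/eqP/negP => /negP xj.
have := kmin (absz (m - j)%R).
have -> : m - (absz (m - j)%R)%:Z = j by lia.
by move=> /(_ xj); lia.
Qed.

(* ldeg 0 = 0 is a junk value. *)
Definition ldeg (x : laurent) : int := xget 0 [set n | is_ldeg x n].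

Lemma ldegP x : x != 0 -> is_ldeg x (ldeg x).
Proof. by move=> /is_ldeg_ex[n xn]; apply: (xgetI 0 xn). Qed.

Fixpoint linv_seq (a : nat -> F) (n : nat) : seq F :=
  if n is n'.+1 then
    let s := linv_seq a n' in
    rcons s ((a 0%N)^-1 * ((n' == 0%N)%:R - \sum_(i < n') a (n' - i)%N * s`_i))
  else [::].

Lemma size_linv_seq a n : size (linv_seq a n) = n.
Proof. by elim: n => //= n IHn; rewrite size_rcons IHn. Qed.

Lemma nth_linv_seq a n i : (i < n)%N -> (linv_seq a n)`_i = (linv_seq a i.+1)`_i.
Proof.
elim: n => // n IHn; rewrite ltnS leq_eqVlt => /predU1P[->//|i_n].
by rewrite [LHS]/= nth_rcons size_linv_seq i_n IHn.
Qed.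

Lemma linv_seqP a n : a 0%N != 0 ->
  \sum_(i < n.+1) a (n - i)%N * (linv_seq a i.+1)`_i = (n == 0%N)%:R.
Proof.
move=> a0; rewrite big_ord_recr /= subnn nth_rcons size_linv_seq ltnn eqxx.
rewrite mulVKf // addrC -addrA [X in _ + X](_ : _ = 0) ?addr0 //.
apply/eqP; rewrite addrC subr_eq0; apply/eqP; apply: eq_bigr => i _.
by rewrite nth_linv_seq.
Qed.

Lemma lmulV_ex (x : laurent) : x != 0 -> exists y : laurent, y * x = 1.
Proof.
move=> /ldegP[]; set d := ldeg x => xd0 xd.
pose a i := x (d - i%:Z).
pose b (j : int) := if - d < j then 0 else (linv_seq a (absz (- d - j)%R).+1)`_(absz (- d - j)%R).
have bd : bounded_by b (- d) by move=> j dj; rewrite /b dj.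
exists (Laurent (ex_intro _ _ bd)); apply: laurentP => j.
rewrite [LHS]/= [RHS]/=.
have [j0|j0] := ltP 0 j.
  by rewrite (lmul_coef_gt bd xd) ?addNr // gt_eqF.
have [k ->] : exists k : nat, j = - d + d - k%:Z.
  by exists (absz j); lia.
rewrite lmul_coefE //.
have a0 : a 0%N != 0 by rewrite /a subr0.
rewrite (_ : (_ == 0) = (k == 0%N)); last by lia.
rewrite -(linv_seqP k a0); apply: eq_bigr => i _.
rewrite mulrC /a /b ifF; last by lia.
by have -> : (absz (- d - (- d - i%:Z))%R) = i by lia.
Qed.

Definition linv (x : laurent) : laurent := xget 0 [set y | y * x = 1].

Fact lmulV (x : laurent) : x != 0 -> linv x * x = 1.
Proof. by move=> /lmulV_ex[y yx]; have := @xgetI _ 0 [set y | y * x = 1] y yx. Qed.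

Fact linv0 : linv 0 = 0.
Proof.
by apply: xgetPN => y /= /esym/eqP; rewrite mulr0 oner_eq0.
Qed.

HB.instance Definition _ := GRing.ComNzRing_isField.Build laurent lmulV linv0.

(* The embedding F[t] -> F((1/t)). *)
Definition lpoly_coef (p : {poly F}) (i : int) : F :=
  if i is Posz n then p`_n else 0.

Fact lpoly_bounded p : exists n, bounded_by (lpoly_coef p) n.
Proof.
by exists (size p)%:Z => -[i|i] //= ip; rewrite nth_default //; lia.
Qed.
Definition lpoly (p : {poly F}) : laurent := Laurent (lpoly_bounded p).

Fact lpoly_is_zmod_morphism : zmod_morphism lpoly.
Proof.
by move=> p q; apply: laurentP => -[i|i] /=; rewrite ?coefB // oppr0 addr0.
Qed.
HB.instance Definition _ :=
  GRing.isZmodMorphism.Build {poly F} laurent lpoly lpoly_is_zmod_morphism.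

Fact lpoly_is_monoid_morphism : monoid_morphism lpoly.
Proof.
split=> [|p q]; first by apply: laurentP => -[i|i]//=; rewrite coef1.
apply: laurentP => j; rewrite [RHS]/=.
pose m := maxn (size p) (maxn (size q) (absz j)).
have [pm qm jm] : [/\ (size p <= m)%N, (size q <= m)%N & (absz j <= m)%N]
  by split; rewrite /m !leq_max leqnn ?orbT.
have -> : lmul_coef (lpoly p) (lpoly q) j = \sum_(i < m.+1) p`_i * lpoly q (j - i%:Z).
  pose r := [seq i%:Z | i <- iota 0 m.+1].
  have ur : uniq r by rewrite map_inj_uniq ?iota_uniq // => i i' [].
  rewrite /lmul_coef -(fsbig_widen [set` r] [set: int]) //; last first.
    move=> i [_ /=] /negP ir; case: i ir => [i|i] /= ir; last by rewrite mul0r.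
    rewrite nth_default ?mul0r //; apply: leq_trans pm _.
    rewrite leqNgt; apply: contra ir => im; apply/mapP; exists i => //.
    by rewrite mem_iota; lia.
  by rewrite -fsbig_seq // big_map -(subn0 m.+1) -/(index_iota 0 _) big_mkord subn0.
clearbody m; case: j jm => [j|j] jm.
  rewrite [LHS]/= coefM (big_ord_widen m.+1 (fun i => p`_i * q`_(j - i))) //.
  rewrite big_mkcond; apply: eq_bigr => i _; case: ifP => ij.
    by have -> : j%:Z - i%:Z = (j - i)%N%:Z by lia.
  have -> : j%:Z - i%:Z = Negz (i - j).-1 by lia.
  by rewrite mulr0.
rewrite /= big1 // => i _.
have -> : Negz j - i%:Z = Negz (j + i) by lia.
by rewrite mulr0.
Qed.
HB.instance Definition _ :=
  GRing.isMonoidMorphism.Build {poly F} laurent lpoly lpoly_is_monoid_morphism.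

End Laurent.

Section PrimeFieldTrace.
Variable F : finFieldType.

Definition charF : nat := s2val (finPcharP F).

Lemma charFP : charF \in [pchar F].
Proof. exact: s2valP' (finPcharP F). Qed.

(* F as a Galois extension of its prime field. *)
Local Notation L := (pPrimeCharType charFP).

Definition Fp_trace (a : F) : 'F_charF :=
  odflt 0 [pick k : 'F_charF | k%:A == galTrace 1%AS {:L} (a : L)].

Lemma Fp_traceE (a : F) : (Fp_trace a)%:A = galTrace 1%AS {:L} (a : L).
Proof.
rewrite /Fp_trace; case: pickP => [k /eqP //|no_k] /=.
have /vlineP[k tr_k] : galTrace 1%AS {:L} (a : L) \in 1%VS.
  by apply: mem_galTrace; rewrite ?memvf // finField_galois ?subvf.
by have := no_k k; rewrite tr_k eqxx.
Qed.

End PrimeFieldTrace.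

Section LargeSieve.
Variables (R : realType) (F : finFieldType).
Implicit Types (x y : laurent F) (f g h k l r : {poly F}) (S : set {poly F}).

Definition linf_norm x : R := if x == 0 then 0 else #|F|%:R ^ ldeg x.

Lemma linf_norm_poly f :
  f != 0 -> linf_norm (lpoly f) = #|F|%:R ^+ (size f).-1.
Proof.
move=> f0.
have lf : is_ldeg (lpoly f) (size f).-1%:Z.
  split; first by rewrite /= -lead_coefE lead_coef_eq0.
  move=> [i|i] //= i_gt; rewrite nth_default //.
  by move: i_gt; rewrite ltz_nat; case: (size f).
have lf0 : lpoly f != 0.
  by apply/eqP => lf0; case: lf => /eqP; rewrite lf0.
rewrite /linf_norm (negPf lf0).
by rewrite (is_ldeg_uniq (ldegP lf0) lf) -exprnP.
Qed.

(* exp (i * theta). *)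
Definition expi (theta : R) : R[i] := (cos theta +i* sin theta)%C.

Definition echar x : R[i] :=
  expi (2 * pi / (charF F)%:R * (Fp_trace (x (- 1)) : nat)%:R).

Lemma echar_periodic x g : echar (x + lpoly g) = echar x.
Proof. by rewrite /echar /= addr0. Qed.

(* Each reduced residue class mod f is represented by its element of degree
   less than deg f; for constant f the only class is that of 0. *)
Definition reduced_residues f : set {poly F} :=
  [set r : {poly F} | (size r < size f)%N /\ coprimep r f].

Lemma echar_frac_mod f g r s :
  f != 0 -> (f %| r - s)%R ->
  echar (lpoly g * (lpoly r / lpoly f)) = echar (lpoly g * (lpoly s / lpoly f)).
Proof.
move=> f0 /dvdpP[u rs].
have lf0 : lpoly f != 0.
  apply: contra f0 => /eqP lf0; rewrite -lead_coef_eq0 lead_coefE.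
  by apply/eqP; have /(congr1 (fun x : laurent F => x (size f).-1%:Z)) := lf0.
rewrite -[r](subrK s) rs rmorphD rmorphM mulrDl mulfK // mulrDr addrC.
by rewrite -rmorphM echar_periodic.
Qed.

(* The zero polynomial, of size 0, has degree at most N. *)
Definition deg_le (N : nat) : set {poly F} := [set g : {poly F} | (size g <= N.+1)%N].

Lemma finite_deg_le N : finite_set (deg_le N).
Proof.
apply: (@sub_finite_set _ _ (range (@rVpoly F N.+1))); last first.
  by apply: finite_image; apply: finite_finset.
by move=> g gN; exists (poly_rV g) => //; rewrite poly_rV_K.
Qed.

Definition ncard (T : choiceType) (A : set T) : nat := #|` fset_set A|%fset.

Definition Sdiv S h : set {poly F} := [set x : {poly F} | S (h * x)].

Lemma finite_Sdiv S (Q0 : nat) h :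
  h != 0 -> S `<=` deg_le Q0 -> finite_set (Sdiv S h).
Proof.
move=> h0 SQ0; apply: sub_finite_set (finite_deg_le Q0) => x /SQ0.
rewrite /deg_le /=; have [->|x0] := eqVneq x 0; first by rewrite size_poly0.
rewrite size_mul //; apply: leq_trans; move: h0; rewrite -size_poly_gt0.
by case: (size h) => // n _; rewrite addSn leq_addl.
Qed.

Definition Sdiv_ball S h (m : int) k l y : set {poly F} :=
  [set x : {poly F} | [/\ Sdiv S h x, linf_norm (lpoly x - y) <= #|F|%:R ^ m & k %| x - l]].

Definition is_Acount S (Q0 : nat) h m k l (n : nat) : Prop :=
  exists2 y, linf_norm y <= #|F|%:R ^ (Q0%:Z - (size h).-1%:Z) &
             n = ncard (Sdiv_ball S h m k l y).

(* The counts are at most #S_h, which makes the maximum one over a finite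
   range; Amax_ub and Amax_attained say that it is the maximum over y. *)
Definition Amax S (Q0 : nat) h m k l : nat :=
  \max_(n < (ncard (Sdiv S h)).+1 | `[< is_Acount S Q0 h m k l n >]) n.

Lemma Acount_le S Q0 h m k l n : finite_set (Sdiv S h) ->
  is_Acount S Q0 h m k l n -> (n <= ncard (Sdiv S h))%N.
Proof.
move=> finS [y _ ->]; apply: fsubset_leq_card.
have sub : Sdiv_ball S h m k l y `<=` Sdiv S h by move=> x [].
by rewrite -fset_set_sub //; apply: sub_finite_set finS.
Qed.

Lemma Amax_ub S Q0 h m k l n : finite_set (Sdiv S h) ->
  is_Acount S Q0 h m k l n -> (n <= Amax S Q0 h m k l)%N.
Proof.
move=> finS An; have := Acount_le finS An; rewrite -ltnS => n_lt.
by apply: (bigop.leq_bigmax_cond (Ordinal n_lt)); apply/asboolP.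
Qed.

Lemma Amax_attained S Q0 h m k l : finite_set (Sdiv S h) ->
  is_Acount S Q0 h m k l (Amax S Q0 h m k l).
Proof.
move=> finS.
have A0 : is_Acount S Q0 h m k l (ncard (Sdiv_ball S h m k l 0)).
  by exists 0 => //; rewrite /linf_norm eqxx exprz_ge0.
have := Acount_le finS A0; rewrite -ltnS => n_lt.
have nA : (0 < #|[pred n : 'I_(ncard (Sdiv S h)).+1 |
                  `[< is_Acount S Q0 h m k l n >]]|)%N.
  by apply/card_gt0P; exists (Ordinal n_lt); apply/asboolP.
have [n nP nE] := bigop.eq_bigmax_cond (fun n : 'I__ => nat_of_ord n) nA.
by rewrite /Amax nE; apply/asboolP.
Qed.

End LargeSieve.

(* Main.v *)
(* The sum over g sees a fraction r/f only through its coefficients of t^-1, ...,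
   t^-(N+1), so Parseval bounds the left side by q^(N+1) K sum |a_g|^2, where K
   is the largest number of fractions r/f with |r/f - alpha| <= q^(-N-2).  By
   Dirichlet, alpha = b/k + z with deg k <= N/2 and |z| <= q^(-N/2) / |k|; put
   m = r k - b f.  If m = 0, then f is a unit times k, giving at most q
   fractions.  If m != 0, let h = gcd(m, k): then h divides f, and f / h lies in
   S_h, in one residue class prime to k / h, and in one ball of radius
   q^(Q0 - deg h - N - 2) / max(|z|, q^(-N-2)), so that the hypothesis bounds the
   number of f.  Summing over m, and over the at most 2^(deg k) divisors h of k
   up to units, gives the theorem with C = q^2. *)
Require Import Defs.
From mathcomp Require Import all_boot all_order all_algebra all_field.
From mathcomp Require Import boolp classical_sets fsbigop reals exp.
From mathcomp Require Import complex.
From mathcomp Require Import finmap cardinality trigo zify ring lra.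

Import Order.TTheory GRing.Theory Num.Theory.

Local Open Scope classical_set_scope.
Local Open Scope ring_scope.

Set Implicit Arguments.
Unset Strict Implicit.
Unset Printing Implicit Defensive.

(** * The additive character of a finite field: orthogonality and Parseval *)

Section AdditiveCharacter.
Variables (R : realType) (F : finFieldType).
Implicit Types (a b : F) (x y : R).

Lemma expiD x y : expi (x + y) = expi x * expi y :> R[i].
Proof.
rewrite /expi cosD sinD; apply/eqP; rewrite eq_complex /=.
by apply/andP; split; apply/eqP; ring.
Qed.

Lemma expi0 : expi 0 = 1 :> R[i].
Proof. by rewrite /expi cos0 sin0. Qed.

Lemma expiMn x n : expi (x * n%:R) = expi x ^+ n.
Proof.
elim: n => [|n IHn]; first by rewrite mulr0 expi0.
by rewrite -natr1 mulrDr mulr1 expiD IHn exprSr.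
Qed.

Lemma expi_2pi : expi (2 * pi) = 1 :> R[i].
Proof. by rewrite /expi mulr_natl cos2pi sin2pi. Qed.

(** cos x = 1 - 2 sin(x/2)^2, and sin(x/2) > 0 because x/2 lies strictly between 0 and pi. *)
Lemma expi_eq1 x : 0 < x < 2 * pi -> expi x != 1.
Proof.
move=> /andP[x0 xpi]; apply/eqP => -[cx _].
have : 0 < sin (x / 2) by apply: sin_gt0_pi; lra.
have := cos2Dsin2 (x / 2); move: cx.
rewrite {1}(_ : x = x / 2 + x / 2); last by field.
rewrite cosD; nra.
Qed.

Lemma expi_conj x : (expi x)^* = expi (- x).
Proof. by rewrite /expi cosN sinN. Qed.

Lemma expi_mul_conj x : expi x * (expi x)^* = 1.
Proof. by rewrite expi_conj -expiD subrr expi0. Qed.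

Local Notation p := (charF F).

Lemma charF_prime : prime p.
Proof. by have /andP[] := charFP F. Qed.

(** Additivity is checked after embedding the prime field in [F], where [Fp_trace] becomes the
    Galois trace. *)
Lemma Fp_traceD a b : Fp_trace (a + b) = Fp_trace a + Fp_trace b.
Proof.
have inj : injective (fun k : 'F_p => k%:A : pPrimeCharType (charFP F)).
  exact: fmorph_inj (in_alg (pPrimeCharType (charFP F))).
by apply: inj; rewrite /= scalerDl !Fp_traceE raddfD.
Qed.

(** A trace vanishing identically would be a linear relation, with all coefficients 1, between the
    Galois automorphisms, against their linear independence. *)
Lemma Fp_trace_neq0 : exists a, Fp_trace a != 0.
Proof.
apply: contrapT => trace0.
pose L := pPrimeCharType (charFP F).
have tr0 : {in {:L}%VS, forall a : L,
    \sum_(x in 'Gal({:L} / 1)%g) (fun=> 1 : L) x * x a = 0}.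
  move=> a _; transitivity (galTrace 1%AS {:L} a).
    by apply: eq_bigr => x _; rewrite mul1r.
  case: (eqVneq (Fp_trace (a : F)) 0) => [a0|a0]; last by case: trace0; exists a.
  by have := Fp_traceE (a : F); rewrite a0 scale0r => <-.
have := gal_independent tr0 (fingroup.group1 _).
by move/eqP; rewrite oner_eq0.
Qed.

(** By definition [echar x] is [addchar] of the coefficient of t^-1 in [x]. *)
Definition addchar a : R[i] :=
  expi (2 * pi / p%:R * (Fp_trace a : nat)%:R).

(** The trace of a sum is a sum modulo p; the reduction does no harm since exp(2 pi i / p) is a p-th
    root of unity. *)
Lemma addcharD a b : addchar (a + b) = addchar a * addchar b.
Proof.
rewrite /addchar Fp_traceD !expiMn -exprD.
set z := expi _; have zp : z ^+ p = 1.
  rewrite /z -expiMn mulfVK ?expi_2pi // pnatr_eq0 -lt0n.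
  exact: prime_gt0 charF_prime.
have modFp m : (m %% (Zp_trunc (pdiv p)).+2 = m %% p)%N.
  by rewrite Fp_cast ?charF_prime.
by rewrite /= modFp expr_mod.
Qed.

Lemma addchar_mul_conj a : addchar a * (addchar a)^* = 1.
Proof. exact: expi_mul_conj. Qed.

Lemma addchar_neq0 a : addchar a != 0.
Proof.
apply/eqP => a0; have /esym/eqP := addchar_mul_conj a.
by rewrite a0 mul0r oner_eq0.
Qed.

Lemma addchar0 : addchar 0 = 1.
Proof.
by apply: (mulfI (addchar_neq0 0)); rewrite -addcharD addr0 mulr1.
Qed.

Lemma addcharN a : addchar (- a) = (addchar a)^*.
Proof.
apply: (mulfI (addchar_neq0 a)).
by rewrite -addcharD subrr addchar0 addchar_mul_conj.
Qed.

(** A nonzero trace has a representative strictly between 0 and p, so the angle lies strictly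
    between 0 and 2 pi. *)
Lemma addchar_neq1 : exists a, addchar a != 1.
Proof.
have [a tra] := Fp_trace_neq0; exists a; apply: expi_eq1.
have p0 : 0 < p%:R :> R by rewrite ltr0n prime_gt0 ?charF_prime.
have trp : ((Fp_trace a : nat) < p)%N.
  by rewrite -{2}(Fp_cast charF_prime) ltn_ord.
have tr0 : (0 < (Fp_trace a : nat))%N by rewrite lt0n.
have pi0 := pi_gt0 R.
apply/andP; split.
  by rewrite !mulr_gt0 ?invr_gt0 // ltr0n.
rewrite -mulrA gtr_pMr ?mulr_gt0 // mulrC ltr_pdivrMr // mul1r ltr_nat //.
Qed.

(** For g nonzero, a shift of u by a suitable v multiplies the sum by a factor other than 1, so the
    sum is 0. *)
Lemma sum_addchar n (g : 'rV[F]_n) :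
  \sum_(u : 'rV[F]_n) addchar (\sum_i g 0 i * u 0 i)
  = if g == 0 then (#|F| ^ n)%:R else 0.
Proof.
case: eqVneq => [->|g0].
  rewrite (eq_bigr (fun=> 1)); last first.
    by move=> u _; rewrite big1 ?addchar0 // => i _; rewrite mxE mul0r.
  by rewrite sumr_const card_mx mul1n.
have [i gi0] : exists i, g 0 i != 0.
  apply: contrapT => ng; move/eqP: g0; apply; apply/rowP => i; rewrite mxE.
  by apply/eqP/negP => /negP gi; apply: ng; exists i.
have [a a1] := addchar_neq1.
(* Chosen so that the pairing of g with v is [a], at which the character is not 1. *)
pose v : 'rV[F]_n := (a / g 0 i) *: delta_mx 0 i.
have gv : \sum_j g 0 j * v 0 j = a.
  rewrite (bigD1 i) //= big1 => [|j ji].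
    by rewrite !mxE !eqxx mulr1 addr0 mulrC divfK.
  by rewrite !mxE (negPf ji) andbF !mulr0.
set s := \sum_u _; have : s = addchar a * s.
  rewrite {1}/s (reindex_inj (addrI v)) /= mulr_sumr; apply: eq_bigr => u _.
  rewrite -addcharD; congr addchar; rewrite -[in RHS]gv -big_split /=.
  by apply: eq_bigr => j _; rewrite mxE mulrDr.
move/eqP; rewrite -subr_eq0 -{1}[s]mul1r -mulrBl mulf_eq0 subr_eq0.
by rewrite eq_sym (negPf a1) => /eqP.
Qed.

Lemma normc_sqr (z : R[i]) : ((ComplexField.Normc.normc z) ^+ 2)%:C%C = z * z^*.
Proof.
by rewrite rmorphXn; have := sqr_normc z; rewrite normc_def => <-; case: z.
Qed.

(** In R[i] the square of a modulus is z times its conjugate; after expansion, the terms with g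
    different from g' vanish by [sum_addchar] at g - g'. *)
Lemma parseval n (c : 'rV[F]_n -> R[i]) :
  \sum_(u : 'rV[F]_n) ComplexField.Normc.normc
     (\sum_g c g * addchar (\sum_i g 0 i * u 0 i)) ^+ 2
  = (#|F| ^ n)%:R * \sum_g ComplexField.Normc.normc (c g) ^+ 2.
Proof.
apply: (@complexI R); rewrite rmorphM !rmorph_sum rmorph_nat /=.
under eq_bigr => u _ do rewrite normc_sqr rmorph_sum mulr_suml.
rewrite exchange_big mulr_sumr; apply: eq_bigr => g _ /=.
under eq_bigr => u _ do rewrite mulr_sumr.
rewrite exchange_big (bigD1 g) //= [X in _ + X]big1 ?addr0 => [|g' g'g].
  rewrite normc_sqr (eq_bigr (fun=> c g * (c g)^*)) => [|u _].
    by rewrite sumr_const card_mx mul1n mulr_natl.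
  rewrite rmorphM mulrACA /addchar expi_mul_conj mulr1 //.
transitivity (\sum_(u : 'rV[F]_n) c g * (c g')^* * addchar (\sum_i (g - g') 0 i * u 0 i)).
  apply: eq_bigr => u _; rewrite rmorphM /= mulrACA -addcharN -addcharD.
  congr (_ * addchar _); rewrite -sumrB; apply: eq_bigr => i _.
  by rewrite !mxE mulrBl.
by rewrite -mulr_sumr sum_addchar subr_eq0 eq_sym (negPf g'g) mulr0.
Qed.

End AdditiveCharacter.

(** * Degrees in F((1/t)) and Dirichlet approximation *)

Section LaurentDegree.
Variable F : fieldType.
Implicit Types (x y : laurent F) (f p : {poly F}).

Lemma bounded_byD x y n : bounded_by x n -> bounded_by y n -> bounded_by (x + y) n.
Proof. by move=> xn yn i ni /=; rewrite xn // yn // addr0. Qed.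

Lemma bounded_byN x n : bounded_by x n -> bounded_by (- x) n.
Proof. by move=> xn i ni /=; rewrite xn // oppr0. Qed.

Lemma bounded_byM x y m n :
  bounded_by x m -> bounded_by y n -> bounded_by (x * y) (m + n).
Proof. exact: lmul_coef_gt. Qed.

Lemma is_ldegM x y m n : is_ldeg x m -> is_ldeg y n -> is_ldeg (x * y) (m + n).
Proof.
move=> [x0 xm] [y0 yn]; split; last exact: bounded_byM.
have := lmul_coefE 0 xm yn; rewrite subr0 big_ord1 /= subr0 subr0 => E.
by rewrite [_ (m + n)]E mulf_neq0.
Qed.

Lemma is_ldeg_neq0 x n : is_ldeg x n -> x != 0.
Proof. by case=> xn _; apply: contra xn => /eqP ->. Qed.

Lemma is_ldeg1 : is_ldeg (1 : laurent F) 0.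
Proof.
by split=> [|i i0] /=; rewrite ?eqxx ?oner_eq0 // gt_eqF.
Qed.

Lemma is_ldegV x n : is_ldeg x n -> is_ldeg x^-1 (- n).
Proof.
move=> xn; have x0 := is_ldeg_neq0 xn.
have [m xm] : exists m, is_ldeg x^-1 m by apply: is_ldeg_ex; rewrite invr_eq0.
have := is_ldegM xn xm; rewrite divff // => /(is_ldeg_uniq is_ldeg1) nm.
by have -> : - n = m by lia.
Qed.

Lemma bounded_by_div x y m n :
  is_ldeg x m -> bounded_by y n -> bounded_by (y / x) (n - m).
Proof. by move=> /is_ldegV[_ xm] yn; apply: bounded_byM. Qed.

Lemma is_ldeg_poly f : f != 0 -> is_ldeg (lpoly f) (size f).-1%:Z.
Proof.
move=> f0; split; first by rewrite /= -lead_coefE lead_coef_eq0.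
move=> [i|i] //= i_gt; rewrite nth_default //.
by move: i_gt; rewrite ltz_nat; case: (size f).
Qed.

Lemma lpolyB f p : lpoly (f - p) = lpoly f - lpoly p.
Proof. exact: rmorphB. Qed.

Lemma lpoly_eq0 f : (lpoly f == 0) = (f == 0).
Proof.
have [->|f0] := eqVneq f 0; first by rewrite rmorph0 eqxx.
exact/negbTE/(is_ldeg_neq0 (is_ldeg_poly f0)).
Qed.

(** With integer subtraction the zero polynomial gets the bound -1; [bounded_by_frac] relies on this
    when f is constant and r = 0. *)
Lemma bounded_by_poly f : bounded_by (lpoly f) ((size f)%:Z - 1).
Proof. by move=> [i|i] //= fi; rewrite nth_default //; lia. Qed.

Lemma size_bounded_by f n : f != 0 -> bounded_by (lpoly f) n -> (size f)%:Z <= n + 1.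
Proof.
move=> f0 fn; have [lf _] := is_ldeg_poly f0.
have : (size f).-1%:Z <= n.
  by rewrite leNgt; apply: contra lf => /fn ->.
by have := size_poly_gt0 f; rewrite f0; lia.
Qed.

Lemma size_mul_pred f p : f != 0 -> p != 0 ->
  size (f * p) = ((size f).-1 + size p)%N.
Proof.
move=> f0 p0; rewrite size_mul //.
by have := size_poly_gt0 f; rewrite f0; case: (size f).
Qed.

Lemma coef_lpolyM p x n j : (size p <= n)%N ->
  (lpoly p * x) j = \sum_(i < n) p`_i * x (j - i%:Z).
Proof.
move=> pn; rewrite [LHS]/= /lmul_coef.
pose r := [seq i%:Z | i <- iota 0 n].
have ur : uniq r by rewrite map_inj_uniq ?iota_uniq // => i i' [].
rewrite -(fsbig_widen [set` r] [set: int]) //; last first.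
  move=> i [_ /=] /negP ir; case: i ir => [i|i] /= ir; last by rewrite mul0r.
  rewrite nth_default ?mul0r //; apply: leq_trans pn _.
  rewrite leqNgt; apply: contra ir => im; apply/mapP; exists i => //.
  by rewrite mem_iota.
by rewrite -fsbig_seq // big_map -(subn0 n) -/(index_iota 0 _) big_mkord subn0.
Qed.

Lemma lpoly_floor x : exists b, bounded_by (x - lpoly b) (- 1).
Proof.
have [n xn] := lcoef_bounded x.
exists (\poly_(i < (absz n).+1) x i%:Z) => -[i|i] /= i1; last by lia.
rewrite coef_poly; case: ltnP => ni; first by rewrite subrr.
by rewrite subr0 xn //; lia.
Qed.

(** Linear algebra replaces the pigeonhole principle: asking that the coefficients of t^-1, ...,
    t^-D in k x vanish puts D linear conditions on the D + 1 coefficients of k. The polynomial part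
    of k x is then b. *)
Lemma dirichlet x (D : nat) : exists k b : {poly F},
  [/\ k != 0, (size k <= D.+1)%N, coprimep b k &
      bounded_by (x - lpoly b / lpoly k) (- (size k).-1%:Z - D%:Z - 1)].
Proof.
(* Entry (i, j) is the contribution of t^i in k to the coefficient of t^(-1-j) in k x. *)
pose A : 'M[F]_(D.+1, D) := \matrix_(i, j) x (- 1 - j%:Z - i%:Z).
have /rowV0Pn[v /sub_kermxP vA v0] : kermx A != 0.
  by rewrite kermx_eq0 /row_free neq_ltn ltnS rank_leq_col.
pose k := rVpoly v; have k0 : k != 0.
  by apply: contra v0 => /eqP k0; rewrite -[v]rVpolyK -/k k0 linear0.
have kD : (size k <= D.+1)%N by exact: size_poly.
have [b xb] := lpoly_floor (lpoly k * x).
have {}xb : bounded_by (lpoly k * x - lpoly b) (- D%:Z - 1).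
  move=> i Di; case: (ltP (- 1) i) => [/xb //|i1].
  have [j [jD ->]] : exists j, (j < D)%N /\ i = - 1 - j%:Z.
    by exists (absz (- 1 - i)%R); split; lia.
  have -> : (lpoly k * x - lpoly b) (- 1 - j%:Z) = (lpoly k * x) (- 1 - j%:Z) - 0.
    rewrite [LHS]/=; congr (_ - _).
    by have -> : - 1 - j%:Z = Negz j by lia.
  rewrite subr0 (coef_lpolyM _ _ kD).
  have := congr1 (fun B : 'rV_D => B 0 (Ordinal jD)) vA.
  rewrite !mxE => E; rewrite -[RHS]E; apply: eq_bigr => l _.
  by rewrite /k coef_rVpoly_ord !mxE.
have lk0 : lpoly k != 0 by rewrite lpoly_eq0.
have xbk : bounded_by (x - lpoly b / lpoly k) (- D%:Z - 1 - (size k).-1%:Z).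
  have -> : x - lpoly b / lpoly k = (lpoly k * x - lpoly b) / lpoly k.
    by field.
  by apply: bounded_by_div => //; exact: is_ldeg_poly.
(* Reducing b / k can only lower deg k, which weakens the required bound. *)
pose g := gcdp b k; have g0 : g != 0 by rewrite gcdp_eq0 negb_and k0 orbT.
have kg : k = k %/ g * g by rewrite divpK // dvdp_gcdr.
have bg : b = b %/ g * g by rewrite divpK // dvdp_gcdl.
have kg0 : k %/ g != 0 by apply: contra k0 => /eqP e; rewrite kg e mul0r.
have kgs : (size (k %/ g)%R <= size k)%N by rewrite leq_divp.
exists (k %/ g), (b %/ g); split => //.
- exact: leq_trans kD.
- by rewrite coprimep_div_gcd // k0 orbT.
have -> : lpoly (b %/ g) / lpoly (k %/ g) = lpoly b / lpoly k.
  rewrite [in RHS]kg [in RHS]bg !rmorphM /= -mulf_div divff ?mulr1 //.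
  by rewrite lpoly_eq0.
apply: bounded_by_le xbk; move: kgs; set u := size (k %/ g); set w := size k; lia.
Qed.

End LaurentDegree.

(** * From degree bounds to norm bounds *)

Section LaurentNorm.
Variables (R : realType) (F : finFieldType).

Lemma finField_gt1 : 1 < #|F|%:R :> R.
Proof. by rewrite ltr1n finNzRing_gt1. Qed.

Lemma linf_norm_le (x : laurent F) n :
  bounded_by x n -> linf_norm R x <= #|F|%:R ^ n.
Proof.
move=> xn; rewrite /linf_norm; case: eqVneq => [_|x0]; first exact: exprz_ge0.
have [lx _] := ldegP x0; rewrite ler_eXz2l ?finField_gt1 //.
by rewrite leNgt; apply: contra lx => /xn ->.
Qed.

End LaurentNorm.

(** * Divisors of a polynomial up to units *)

Section Divisors.
Variable F : fieldType.
Implicit Types h k p : {poly F}.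

(* If p is a nonconstant divisor of k of least degree, every h is either
   divisible by p or coprime to p, so the divisors of k are, up to units, those
   of k / p and their products with p. *)
Lemma divisor_list k : k != 0 -> exists s : seq {poly F},
  [/\ (size s <= 2 ^ (size k).-1)%N,
      (forall h, h \in s -> h %| k) &
      (forall h, h %| k -> exists2 h', h' \in s & h %= h')].
Proof.
have [n] := ubnP (size k); elim: n k => // n IHn k kn k0.
have [k1|k1] := leqP (size k) 1.
  exists [:: 1]; split=> [|h|h hk]; first by rewrite expn_gt0.
    by rewrite inE => /eqP ->; rewrite dvd1p.
  exists 1; rewrite ?inE //; rewrite -size_poly_eq1.
  rewrite eqn_leq (leq_trans (dvdp_leq k0 hk)) // size_poly_gt0.
  by apply: contra k0 => /eqP h0; rewrite h0 dvd0p in hk.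
(* A size of the form d + 2 expresses that p is nonconstant; k itself is a candidate. *)
have ex : exists d, `[< exists2 p, p %| k & size p = d.+2 >].
  exists (size k).-2; apply/asboolP; exists k; rewrite ?dvdpp //; by case: (size k) k1 => [|[]].
case: (ex_minnP ex) => d /asboolP[p pk pd] dmin.
have p0 : p != 0 by rewrite -size_poly_gt0 pd.
have cop h : ~~ (p %| h) -> coprimep h p.
  move=> nph; rewrite /coprimep eqn_leq size_poly_gt0 gcdp_eq0 (negPf p0) andbF andbT.
  rewrite leqNgt; apply: contra nph => g2.
  have /dmin : `[< exists2 p', p' %| k & size p' = (size (gcdp h p)).-2.+2 >].
    apply/asboolP; exists (gcdp h p); last by move: g2; set u := size (gcdp h p); case: u => [|[]].
    exact: dvdp_trans (dvdp_gcdr h p) pk.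
  move=> dg; have : gcdp h p %= p.
    rewrite -dvdp_size_eqp ?dvdp_gcdr //.
    by have := dvdp_leq p0 (dvdp_gcdr h p); move: g2 dg; rewrite pd; set u := size (gcdp h p); lia.
  by move/eqp_dvdl <-; rewrite dvdp_gcdl.
have kE : k = k %/ p * p by rewrite divpK.
have kp0 : k %/ p != 0 by apply: contra k0 => /eqP e; rewrite kE e mul0r.
have kps : ((size (k %/ p)%R).-1.+1 <= (size k).-1)%N.
  have := size_poly_gt0 (k %/ p); rewrite kp0 size_divp // pd.
  by set u := size k; lia.
have [s [ss sk sall]] : exists s : seq {poly F},
    [/\ (size s <= 2 ^ (size (k %/ p)%R).-1)%N, forall h, h \in s -> h %| k %/ p
      & forall h, h %| k %/ p -> exists2 h', h' \in s & h %= h'].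
  by apply: IHn => //; move: kps kn; set u := size (k %/ p); set w := size k; lia.
exists (s ++ [seq h * p | h <- s]); split.
- rewrite size_cat size_map addnn -muln2 mulnC.
  apply: leq_trans (leq_pexp2l _ kps) => //.
  by rewrite expnS leq_mul2l ss.
- move=> h; rewrite mem_cat => /orP[/sk hk|/mapP[h' /sk hk ->]].
    by rewrite kE dvdp_mulr.
  by rewrite kE dvdp_mul.
move=> h hk; have [ph|/cop ph] := boolP (p %| h).
  have hE : h = h %/ p * p by rewrite divpK.
  have /sall[h' h's hh'] : h %/ p %| k %/ p.
    by rewrite -(dvdp_mul2r _ _ p0) -hE -kE.
  exists (h' * p); first by rewrite mem_cat; apply/orP; right; apply/mapP; exists h'.
  by rewrite hE eqp_mul2r.
have /sall[h' h's hh'] : h %| k %/ p.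
  by rewrite -(Gauss_dvdpl _ ph) -kE.
by exists h' => //; rewrite mem_cat h's.
Qed.

End Divisors.

(** * Counting the fractions near a given point *)

Section Counting.

(** Union bound: every entry of [A] is counted at least once on the right. *)
Lemma size_le_sum_count (T I : eqType) (A : seq T) (s : seq I) (P : I -> pred T) :
  (forall x, x \in A -> exists2 i, i \in s & P i x) ->
  (size A <= \sum_(i <- s) count (P i) A)%N.
Proof.
elim: A => [//|x A IHA] cov /=.
rewrite big_split /= -add1n leq_add //; last first.
  by apply: IHA => y yA; apply: cov; rewrite inE yA orbT.
have [|i is_ Pix] := cov x; first by rewrite inE eqxx.
by rewrite (big_rem i) //= Pix.
Qed.

Lemma ncard_inj (T U : choiceType) (A : set T) (B : set U) (f : T -> U) :
  finite_set A -> finite_set B -> {in A &, injective f} ->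
  (forall x, A x -> B (f x)) -> (ncard A <= ncard B)%N.
Proof.
move=> fA fB finj fAB; rewrite /ncard -(size_map f).
apply: uniq_leq_size.
  rewrite map_inj_in_uniq ?fset_uniq // => x y.
  by rewrite !in_fset_set //; apply: finj.
move=> y /mapP[x]; rewrite in_fset_set // => /set_mem Ax ->.
by rewrite in_fset_set //; apply/mem_set/fAB.
Qed.

Variables (R : realType) (F : finFieldType).
Implicit Types (f k b h n r : {poly F}).

Local Notation q := (#|F|%:R : R).

Lemma q_gt0 : 0 < q.
Proof. exact: lt_trans ltr01 (finField_gt1 R F). Qed.

(** The bound is an integer so that [size_poly_seq] holds for either sign: the exponent met in
    [count_near] may be negative. *)
Definition poly_seq (e : int) : seq {poly F} :=
  if e is Posz m then [seq rVpoly v | v <- enum 'rV[F]_m] else [::].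

Lemma mem_poly_seq e n : n != 0 -> (size n)%:Z <= e -> n \in poly_seq e.
Proof.
move=> n0; case: e => [m|m]; last by case: (size n).
rewrite lez_nat => nm; apply/mapP; exists (poly_rV n); rewrite ?mem_enum //.
by rewrite poly_rV_K.
Qed.

Lemma size_poly_seq e : (size (poly_seq e))%:R <= q ^ e.
Proof.
case: e => [m|m]; last by rewrite /= exprz_ge0 // ltW // q_gt0.
by rewrite size_map -cardE card_mx mul1n natrX exprnP.
Qed.

Variables (N Q0 : nat) (S : set {poly F}) (X : R).
Hypothesis S_deg : forall f, S f -> f != 0 /\ (size f <= Q0.+1)%N.
Hypothesis X1 : 1 <= X.
(** The condition |k| <= q^(N/2) appears as deg k <= [N./2]. *)
Hypothesis S_equidistributed : forall h (m : int) k l,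
  h != 0 -> 0 <= m -> m <= Q0%:Z - (size h).-1%:Z ->
  k != 0 -> (size k <= N./2.+1)%N -> coprimep k l ->
  (Amax R S Q0 h m k l)%:R
  <= (1 + ((ncard (Sdiv S h))%:R / linf_norm R (lpoly k))
          / (q ^+ Q0 / linf_norm R (lpoly h)) * q ^ m) * X.

Lemma finite_S : finite_set S.
Proof.
by apply: sub_finite_set (finite_deg_le F Q0) => f /S_deg[].
Qed.

Lemma ncard_Sdiv h : h != 0 -> (ncard (Sdiv S h) <= ncard S)%N.
Proof.
move=> h0; apply: (@ncard_inj _ _ _ _ (fun x => h * x)) => //.
- by apply: (finite_Sdiv (Q0 := Q0)) h0 _ => f /S_deg[].
- exact: finite_S.
- by move=> x y _ _ /(mulfI h0).
Qed.

Lemma bounded_by_S f : S f -> bounded_by (lpoly f) Q0.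
Proof.
move=> /S_deg[_ fQ]; apply: bounded_by_le (@bounded_by_poly F f).
by rewrite lerBlDr lez_nat addn1.
Qed.

Section Near.
Variables (alpha : laurent F) (k b : {poly F}) (w : int).
Hypothesis k0 : k != 0.
Hypothesis kN : (size k <= N./2.+1)%N.
Hypothesis cop_bk : coprimep b k.
Let z := alpha - lpoly b / lpoly k.
(** In [count_near], [w] is the larger of deg z and -N-2. The second case of [zw] covers a z,
    possibly 0, that is no larger than the allowed error in r/f. *)
Hypothesis wN : - N%:Z - 2 <= w.
Hypothesis zw : is_ldeg z w \/ w = - N%:Z - 2.

Variable A : seq ({poly F} * {poly F}).
Hypothesis uA : uniq A.
Hypothesis A_near : forall f r, (f, r) \in A ->
  S f /\ bounded_by (lpoly r / lpoly f - alpha) (- N%:Z - 2).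

(** This identity serves twice: it bounds the degree of m, and it compares two denominators that
    share the same m. *)
Lemma numerator_eq f r : f != 0 ->
  lpoly (r * k - b * f) = lpoly f * lpoly k * (z + (lpoly r / lpoly f - alpha)).
Proof.
move=> f0; rewrite rmorphB !rmorphM /=.
have lf0 : lpoly f != 0 by rewrite lpoly_eq0.
have lk0 : lpoly k != 0 by rewrite lpoly_eq0.
by rewrite /z; field; rewrite lf0.
Qed.

(* With m = r k - b f fixed, the identity f k (z + (r/f - alpha)) = m confines f
   to a ball of radius q^(Q0 - N - 2 - w). *)
Lemma same_numerator_near f r f' r' : (f, r) \in A -> (f', r') \in A ->
  r * k - b * f = r' * k - b * f' ->
  bounded_by (lpoly (f - f')) (Q0%:Z - N%:Z - 2 - w).
Proof.
move=> /A_near[Sf fr] /A_near[Sf' fr'] eq_m.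
have fQ := bounded_by_S Sf; have fQ' := bounded_by_S Sf'.
have [f0 _] := S_deg Sf; have [f0' _] := S_deg Sf'.
rewrite lpolyB.
(* For w = -N-2 the radius is q^Q0, and the degree bound on [S] suffices. *)
case: zw => [zw_|->]; last first.
  apply: (@bounded_by_le _ _ Q0%:Z); first lia.
  by apply: (@bounded_byD F (lpoly f) (- lpoly f')) => //; apply: bounded_byN.
have lk0 : lpoly k != 0 by rewrite lpoly_eq0.
have z0 := is_ldeg_neq0 zw_.
set d := lpoly r / lpoly f - alpha in fr.
set d' := lpoly r' / lpoly f' - alpha in fr'.
have : lpoly f * lpoly k * (z + d) = lpoly f' * lpoly k * (z + d').
  by rewrite -!numerator_eq // eq_m.
rewrite -!(mulrA _ (lpoly k)) !(mulrCA _ (lpoly k)) => /(mulfI lk0) E.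
(* From f (z + d) = f' (z + d'): the terms in d and d' have degree at most Q0 - N - 2, and dividing
   by z lowers this by w. *)
have -> : lpoly f - lpoly f' = (lpoly f' * d' - lpoly f * d) / z.
  apply: (mulIf z0); rewrite divfK //.
  transitivity (lpoly f * (z + d) - lpoly f' * z - lpoly f * d); first by ring.
  by rewrite E; ring.
apply: bounded_by_div => //.
rewrite -!(addrA Q0%:Z).
by apply: bounded_byD; last apply: bounded_byN; apply: bounded_byM.
Qed.

(** Writing m = h n with h a gcd of m and k makes n prime to k / h; hence f / h falls in a class
    prime to k / h. *)
Definition fiber h n : pred ({poly F} * {poly F}) :=
  [pred fr | (fr.2 * k - b * fr.1 == h * n) && (gcdp (h * n) k %= h)].

(** With m and f fixed, r k = m + b f determines r. *)
Lemma fiber_inj h n fr fr' : fr \in A -> fiber h n fr -> fiber h n fr' ->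
  fr.1 = fr'.1 -> fr = fr'.
Proof.
case: fr fr' => [f r] [f' r'] _ /= /andP[/eqP E _] /andP[/eqP E' _] ff'.
congr pair => //; subst f'; apply: (mulIf k0).
by have := E; rewrite -E' => /(congr1 (+%R^~ (b * f))); rewrite !subrK.
Qed.

(** With x = f / h and k' = k / h, the equation r k' - b x = n fixes x modulo k', because b is
    invertible there; [same_numerator_near] confines x to a ball. *)
Lemma count_fiber h n : h != 0 -> h %| k ->
  (count (fiber h n) A)%:R
  <= X * (1 + (ncard S)%:R
              * q ^ ((size h).-1%:Z - (size k).-1%:Z - N%:Z - 2 - w)).
Proof.
move=> h0 hk; have q0 := q_gt0.
have X0 : 0 <= X by apply: le_trans X1.
have Bge0 e : 0 <= (ncard S)%:R * q ^ e.
  by rewrite mulr_ge0 // exprz_ge0 // ltW.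
pose k' := k %/ h; have kE : k = h * k' by rewrite mulrC divpK.
have k0' : k' != 0 by apply: contra k0 => /eqP e; rewrite kE e mulr0.
rewrite -size_filter; set B := filter _ A.
have uB : uniq B by rewrite filter_uniq.
have BP fr : fr \in B -> fr \in A /\ fiber h n fr.
  by rewrite mem_filter => /andP[].
case EB : B => [|[f0 r0] B'].
  by rewrite mulr_ge0 // addr_ge0.
have B0 : (f0, r0) \in B by rewrite EB inE eqxx.
rewrite -EB; clear B' EB; have [A0 P0] := BP _ B0.
(* h divides k and m, hence b f; as a divisor of k it is prime to b. *)
have hf f r : (f, r) \in B -> h %| f.
  move=> /BP[_ /andP[/eqP /= E _]].
  have : h %| b * f.
    have -> : b * f = r * k - h * n by rewrite -E opprB addrC subrK.
    by rewrite dvdp_sub ?dvdp_mulIl // dvdp_mull.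
  by rewrite Gauss_dvdpr // coprimep_sym; apply: coprimep_dvdl cop_bk.
pose x0 := f0 %/ h; have f0E : f0 = h * x0 by rewrite mulrC divpK // (hf _ _ B0).
have xE f r : (f, r) \in B -> r * k' - b * (f %/ h) = n.
  move=> Bf; have := BP _ Bf => -[_ /andP[/eqP /= E _]].
  apply: (mulfI h0); rewrite -E [in RHS]kE -[in RHS](divpK (hf _ _ Bf)); ring.
have cop_nk : coprimep n k'.
  case/andP: P0 => _ /=; rewrite [in X in gcdp _ X]kE => gh.
  rewrite /coprimep size_poly_eq1 -(eqp_mul2l _ _ h0) mulr1.
  by apply: eqp_trans (mulp_gcdr _ _ _) _.
(* A common divisor of k' and x0 divides n = r0 k' - b x0, which is prime to k'. *)
have cop_kx : coprimep k' x0.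
  apply/coprimepP => d dk dx; rewrite -size_poly_eq1.
  move/coprimepP: cop_nk => /(_ d); rewrite -size_poly_eq1; apply => //.
  by rewrite -(xE _ _ B0) dvdp_sub // dvdp_mull.
have cop_bk' : coprimep k' b.
  by rewrite coprimep_sym; apply: coprimep_dvdl cop_bk; rewrite kE dvdp_mulIr.
(* The radius from [same_numerator_near], divided by |h|. *)
pose m' : int := Q0%:Z - (size h).-1%:Z - N%:Z - 2 - w.
have near f r : (f, r) \in B -> bounded_by (lpoly (f - f0)) (Q0%:Z - N%:Z - 2 - w).
  move=> /BP[Af /andP[/eqP /= E _]]; apply: (same_numerator_near Af A0).
  by case/andP: P0 => /eqP /= -> _.
have nearx f r : (f, r) \in B -> bounded_by (lpoly (f %/ h) - lpoly x0) m'.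
  move=> Bf; have -> : lpoly (f %/ h) - lpoly x0 = lpoly (f - f0) / lpoly h.
    have -> : f - f0 = h * (f %/ h - x0).
      by rewrite mulrBr -f0E mulrC (divpK (hf _ _ Bf)).
    by rewrite -lpolyB rmorphM /= mulrC mulKf // lpoly_eq0.
  have m'E : m' = Q0%:Z - N%:Z - 2 - w - (size h).-1%:Z by rewrite /m'; ring.
  rewrite m'E; by apply: bounded_by_div (near _ _ Bf); apply: is_ldeg_poly.
(* The hypothesis covers only nonnegative exponents. For m' < 0 two values of f / h differ by a
   polynomial of negative degree, so they agree and the fiber has one element. *)
have [m0|m0] := ltP m' 0.
  have allB : all (pred1 (f0, r0)) B.
    apply/allP => -[f r] Bf /=; have [Af Pf] := BP _ Bf.
    apply/eqP/(fiber_inj Af Pf P0) => /=.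
    rewrite -(divpK (hf _ _ Bf)) [RHS]f0E mulrC; congr (_ * _); apply/eqP.
    rewrite -subr_eq0; apply/negP => /negP d0.
    have := nearx _ _ Bf; rewrite -lpolyB => /(size_bounded_by d0).
    rewrite leNgt => /negP; apply; apply: (@le_lt_trans _ _ 0); first by rewrite lezD1.
    by rewrite ltz_nat size_poly_gt0.
  have : (size B <= 1)%N.
    apply: (@uniq_leq_size _ B [:: (f0, r0)] uB) => x /(allP allB) /= /eqP ->.
    by rewrite inE.
  move=> sB; apply: le_trans (_ : 1 * 1 <= _); first by rewrite mulr1 lern1.
  by apply: ler_pM => //; rewrite lerDl.
have SA f r : (f, r) \in A -> S f by move=> /A_near[].
have finSh : finite_set (Sdiv S h).
  by apply: (finite_Sdiv (Q0 := Q0)) h0 _ => f /S_deg[].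
(* One fraction of the fiber supplies both the centre and the residue class; the centre is
   admissible since deg x0 <= Q0 - deg h. *)
pose ball := Sdiv_ball R S h m' k' x0 (lpoly x0).
have fin_ball : finite_set ball by apply: sub_finite_set finSh => x [].
have sizeB : (size B <= ncard ball)%N.
  rewrite /ncard -(size_map (fun fr => fr.1 %/ h)); apply: uniq_leq_size.
    rewrite map_inj_in_uniq // => -[f r] [f' r'] Bf Bf' /= ff'.
    have [Af Pf] := BP _ Bf; have [Af' Pf'] := BP _ Bf'.
    apply: (fiber_inj Af Pf Pf') => /=.
    by rewrite -(divpK (hf _ _ Bf)) ff' (divpK (hf _ _ Bf')).
  move=> x /mapP[[f r] Bf /= ->]; have [Af Pf] := BP _ Bf.
  rewrite in_fset_set //; apply/mem_set; split.
  - by rewrite /Sdiv /= mulrC (divpK (hf _ _ Bf)); apply: SA Af.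
  - exact: linf_norm_le (nearx _ _ Bf).
  rewrite -(Gauss_dvdpr _ cop_bk').
  have -> : b * (f %/ h - x0) = (r - r0) * k'.
    have := xE _ _ Bf; rewrite -(xE _ _ B0) -/x0 => E.
    transitivity (b * (f %/ h) + (r * k' - b * (f %/ h)) - r0 * k'); last by ring.
    by rewrite E; ring.
  exact: dvdp_mulIr.
have [f00 f0Q] := S_deg (SA _ _ A0).
have x00 : x0 != 0 by apply: contra f00 => /eqP e; rewrite f0E e mulr0.
move: f0Q; rewrite f0E size_mul_pred // => f0Q.
have := S_equidistributed (h := h) (m := m') (k := k') (l := x0) h0 m0.
have sk' : size k = ((size h).-1 + size k')%N by rewrite kE size_mul_pred.
have hm : m' <= Q0%:Z - (size h).-1%:Z.
  by rewrite /m'; move: wN; clear; lia.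
have k'N : (size k' <= N./2.+1)%N by apply: leq_trans kN; rewrite sk' leq_addl.
move=> /(_ hm k0' k'N cop_kx) H.
apply: le_trans (_ : (Amax R S Q0 h m' k' x0)%:R <= _).
  rewrite ler_nat; apply: leq_trans sizeB _.
  apply: (Amax_ub finSh); exists (lpoly x0) => //.
  apply: linf_norm_le; apply: bounded_by_le (@bounded_by_poly F _).
  move: f0Q; set u := (size h).-1; set v := size x0; clearbody u v; clear; lia.
apply: le_trans H _.
rewrite mulrC ler_wpM2l // lerD2l !linf_norm_poly //.
rewrite invf_div !mulrA.
apply: le_trans (_ : (ncard S)%:R / q ^+ (size k').-1 * q ^+ (size h).-1 / q ^+ Q0 * q ^ m' <= _).
  do 4 (apply: ler_wpM2r; first by rewrite ?invr_ge0 ?exprn_ge0 ?exprz_ge0 // ltW).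
  by rewrite ler_nat ncard_Sdiv.
(* All powers of q combine, with deg k' = deg k - deg h. *)
rewrite -!mulrA ler_wpM2l // !exprnN !exprnP -!expfzDr ?gt_eqF //.
rewrite ler_eXz2l ?finField_gt1 // /m' sk'.
have := size_poly_gt0 k'; rewrite k0'.
by set u := (size h).-1; set v := size k'; clearbody u v; clear; lia.
Qed.

End Near.


(** Both r / f and b / k are reduced, so r k = b f makes f and k divide each other. Then f is
    determined by its leading coefficient, and r by f. *)
Lemma count_zero_numerator k b (A : seq ({poly F} * {poly F})) :
  k != 0 -> coprimep b k -> uniq A ->
  (forall f r, (f, r) \in A -> f != 0 /\ coprimep r f) ->
  (count [pred fr | (fr.2 * k == b * fr.1)%R] A <= #|F|)%N.
Proof.
move=> k0 cop_bk uA HA; rewrite -size_filter; set B := filter _ A.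
have BP f r : (f, r) \in B -> [/\ f != 0, coprimep r f & r * k = b * f].
  by rewrite mem_filter => /andP[/eqP /= E /HA[]].
have fk f r : (f, r) \in B -> f %= k.
  move=> /BP[f0 rf E]; rewrite /eqp; apply/andP; split.
    have : f %| r * k by rewrite E dvdp_mulIr.
    by rewrite Gauss_dvdpr // coprimep_sym.
  have : k %| b * f by rewrite -E dvdp_mulIr.
  by rewrite Gauss_dvdpr // coprimep_sym.
rewrite -(size_map (fun fr => lead_coef fr.1)); set L := map _ B.
suff uL : uniq L by rewrite -(card_uniqP uL) max_card.
rewrite map_inj_in_uniq ?filter_uniq // => -[f r] [f' r'] Bf Bf' /= ll.
have [f0 _ E] := BP _ _ Bf; have [f0' _ E'] := BP _ _ Bf'.
have ff' : f = f'.
  have /eqpP[[c c'] /= /andP[c0 c0'] cc] : f %= f'.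
    by apply: eqp_trans (fk _ _ Bf) _; rewrite eqp_sym; apply: fk Bf'.
  have := congr1 lead_coef cc; rewrite !lead_coefZ ll.
  have l0 : lead_coef f' != 0 by rewrite lead_coef_eq0.
  move/(mulIf l0) => ccE; move: cc; rewrite ccE.
  by apply: scalerI.
by rewrite -ff' in E' *; congr pair; apply: (mulIf k0); rewrite E.
Qed.

(** The term q accounts for m = 0; the rest sums [count_fiber] over the pairs (h, n). *)
Lemma count_near (alpha : laurent F) (A : seq ({poly F} * {poly F})) :
  uniq A ->
  (forall f r, (f, r) \in A ->
    [/\ S f, coprimep r f & bounded_by (lpoly r / lpoly f - alpha) (- N%:Z - 2)]) ->
  (size A)%:R <= q + 2 ^+ N./2 * (X * (q ^ (Q0%:Z - N./2%:Z)
                                      + (ncard S)%:R * q ^ (Q0%:Z - N%:Z))).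
Proof.
move=> uA HA; have q0 := q_gt0; have q1 := finField_gt1 R F.
have X0 : 0 <= X by apply: le_trans X1.
have [k [b [k0 kN cop_bk]]] := dirichlet alpha N./2.
set z := alpha - _ => zk.
have [w [wN wk zw zwb]] : exists w, [/\ - N%:Z - 2 <= w,
    w <= - (size k).-1%:Z - N./2%:Z - 1, is_ldeg z w \/ w = - N%:Z - 2
    & bounded_by z w].
  have kN' : - N%:Z - 2 <= - (size k).-1%:Z - N./2%:Z - 1.
    by move: kN; set u := size k; clearbody u; clear; lia.
  have [z0|z0] := eqVneq z 0.
    exists (- N%:Z - 2); split => //; first by right.
    by rewrite z0.
  have [d [zd0 zd]] := is_ldeg_ex z0.
  have [dN|dN] := leP (- N%:Z - 2) d.
    exists d; split => //; last by left.
    by rewrite leNgt; apply: contra zd0 => /zk ->.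
  exists (- N%:Z - 2); split=> //; first by right.
  by apply: bounded_by_le zd; apply: ltW.
have HA0 f r : (f, r) \in A -> f != 0 /\ coprimep r f.
  by move=> /HA[/S_deg[]].
have := count_zero_numerator k0 cop_bk uA HA0.
set Z := [pred fr | _] => cZ.
rewrite -(count_predC Z A) natrD lerD // ?ler_nat //.
rewrite -size_filter; set A1 := filter _ A.
have uA1 : uniq A1 by rewrite filter_uniq.
have [s [ss sk sall]] := divisor_list k0.
pose e h : int := Q0%:Z + (size k).-1%:Z + w + 1 - (size h).-1%:Z.
pose idx := [seq (h, n) | h <- s, n <- poly_seq (e h)].
(* The exponent [e h] bounds the size of n = m / h: m has degree at most Q0 + deg k + w, and the 1
   converts degree to size. *)
have A1_near f r : (f, r) \in A1 ->
    S f /\ bounded_by (lpoly r / lpoly f - alpha) (- N%:Z - 2).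
  by rewrite mem_filter => /andP[_ /HA[]].
have cover fr : fr \in A1 -> exists2 i, i \in idx & fiber k b i.1 i.2 fr.
  case: fr => f r A1f; have [Sf fr] := A1_near _ _ A1f.
  have [f0 fQ] := S_deg Sf.
  pose m := r * k - b * f; have m0 : m != 0.
    by move: A1f; rewrite mem_filter subr_eq0 => /andP[].
  have [h hs gh] := sall (gcdp m k) (dvdp_gcdr _ _).
  have hm : h %| m by rewrite -(eqp_dvdl _ gh) dvdp_gcdl.
  have mE : m = h * (m %/ h) by rewrite mulrC divpK.
  have h0 : h != 0 by apply: contra m0 => /eqP e0; rewrite mE e0 mul0r.
  have n0 : m %/ h != 0 by apply: contra m0 => /eqP e0; rewrite mE e0 mulr0.
  exists (h, m %/ h); last by rewrite /fiber /= -mE eqxx.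
  apply/allpairsPdep; exists h, (m %/ h); split=> //.
  apply: mem_poly_seq => //.
  have : bounded_by (lpoly m) (Q0%:Z + (size k).-1%:Z + w).
    rewrite /m (numerator_eq alpha b k0 r f0).
    apply: bounded_byM; last first.
      apply: bounded_byD => //.
      by apply: bounded_by_le fr.
    apply: bounded_byM; first exact: (bounded_by_S Sf).
    by have [] := is_ldeg_poly k0.
  move/(size_bounded_by m0); rewrite [in X in X -> _]mE size_mul_pred // /e.
  set u := (size h).-1; set v := size _; set t := (size k).-1.
  by clearbody u v t; clear; lia.
have := size_le_sum_count cover; rewrite -(ler_nat R) => /le_trans; apply.
rewrite natr_sum big_allpairs_dep /=.
pose B : R := X * (q ^ (Q0%:Z - N./2%:Z) + (ncard S)%:R * q ^ (Q0%:Z - N%:Z)).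
have B0 : 0 <= B.
  by rewrite mulr_ge0 // addr_ge0 ?mulr_ge0 // exprz_ge0 // ltW.
(* Each divisor h will contribute at most [B], and there are at most 2^(deg k) <= 2^(N/2) of
   them. *)
apply: le_trans (_ : \sum_(h <- s) B <= _); last first.
  rewrite big_const_seq count_predT iter_addr_0 -(mulr_natl B); apply: ler_wpM2r => //.
  apply: le_trans (_ : (2 ^ (size k).-1)%:R <= _); first by rewrite ler_nat.
  rewrite natrX ler_weXn2l ?ler1n //.
  by move: kN; set u := size k; case: u.
rewrite big_seq [leRHS]big_seq; apply: ler_sum => h hs.
have hk := sk _ hs; have h0 : h != 0.
  by apply: contra k0 => /eqP h0; move: hk; rewrite h0 dvd0p.
pose B1 : R := X * (1 + (ncard S)%:R
    * q ^ ((size h).-1%:Z - (size k).-1%:Z - N%:Z - 2 - w)).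
have cf n : (count (fiber k b h n) A1)%:R <= B1.
  by have := count_fiber k0 kN cop_bk wN zw uA1 A1_near n h0 hk; apply.
apply: le_trans (_ : \sum_(n <- poly_seq (e h)) B1 <= _).
  by apply: ler_sum => n _.
have B10 : 0 <= B1 by apply: le_trans (cf 0); rewrite ler0n.
rewrite big_const_seq count_predT iter_addr_0 -(mulr_natl B1).
apply: le_trans (_ : q ^ e h * B1 <= _).
  by apply: ler_wpM2r => //; apply: size_poly_seq.
(* The first exponent is at most Q0 - [N./2] by the Dirichlet bound on w; in the second, w, deg k
   and deg h cancel, leaving Q0 - N - 1. *)
rewrite /B1 /B mulrCA ler_wpM2l // mulrDr mulr1 mulrCA -expfzDr ?gt_eqF //.
apply: lerD; last apply: ler_wpM2l => //.
  rewrite ler_eXz2l // /e; move: wk; set u := (size h).-1; set t := (size k).-1.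
  by clearbody u t; clear; lia.
rewrite ler_eXz2l // /e; set u := (size h).-1; set t := (size k).-1.
by clearbody u t; clear; lia.
Qed.

End Counting.

(** * Comparison of the counting bound with the stated bound *)

Section SieveBound.
Variables (R : realType) (q : R) (q1 : 1 < q).

Lemma powR_half_norm (N : nat) : (q ^- N) `^ (- (1 / 2)) = q `^ (N%:R / 2).
Proof.
have q0 : 0 <= q by apply/ltW/(lt_trans ltr01).
rewrite -powR_mulrn // -powRN -powRrM; congr (_ `^ _).
by rewrite mulrNN mulrA mulr1.
Qed.

Lemma exprn_le_powR (d : nat) (s : R) : d%:R <= s -> q ^+ d <= q `^ s.
Proof.
move=> ds; rewrite -powR_mulrn; last by apply/ltW/(lt_trans ltr01).
by apply: ler_powR => //; apply: ltW.
Qed.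

Lemma half_le (N : nat) : (N./2)%:R <= N%:R / 2 :> R.
Proof.
rewrite ler_pdivlMr // -natrM ler_nat muln2 -{2}[N]odd_double_half.
exact: leq_addl.
Qed.

(** The factor q^2 absorbs the rounding of N/2: N + 1 - [N./2] <= N/2 + 2, while the other two terms
    exceed their targets by q^2 and q. *)
Lemma sieve_bound_le (N Q0 s : nat) (X : R) : 0 <= X ->
  q ^+ N.+1 * (q + 2 ^+ N./2 * (X * (q ^ (Q0%:Z - N./2%:Z) + s%:R * q ^ (Q0%:Z - N%:Z))))
  <= q ^+ 2 * (q ^+ N + q ^+ Q0 * X * 2 `^ (N%:R / 2) * (q `^ (N%:R / 2) + s%:R)).
Proof.
move=> X0; have q0 : 0 < q by apply: lt_trans ltr01 q1.
have two_le : 2 ^+ N./2 <= 2 `^ (N%:R / 2) :> R.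
  by rewrite -powR_mulrn; [apply: ler_powR; [lra|exact: half_le]|lra].
have main_le : q ^+ N.+1 * q ^ (Q0%:Z - N./2%:Z) <= q ^+ 2 * q ^+ Q0 * q `^ (N%:R / 2).
  have -> : q ^+ N.+1 * q ^ (Q0%:Z - N./2%:Z) = q ^+ Q0 * q ^+ (N.+1 - N./2).
    rewrite !exprnP -!expfzDr ?gt_eqF //; congr (q ^ _).
    by rewrite -{1 3}[N]odd_double_half; lia.
  rewrite (mulrC (q ^+ 2)) -mulrA ler_pM2l ?exprn_gt0 //.
  rewrite -[q ^+ 2]powR_mulrn ?(ltW q0) // -powRD; last by apply/implyP => _; rewrite gt_eqF.
  apply: exprn_le_powR.
  have : (N.+1 - N./2)%:R * 2 <= (N + 4)%:R :> R.
    by rewrite -natrM ler_nat -{1 3}[N]odd_double_half; lia.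
  by rewrite natrD; lra.
have side_le : q ^+ N.+1 * q ^ (Q0%:Z - N%:Z) <= q ^+ 2 * q ^+ Q0.
  have -> : q ^+ N.+1 * q ^ (Q0%:Z - N%:Z) = q ^+ Q0.+1.
    by rewrite !exprnP -!expfzDr ?gt_eqF //; congr (q ^ _); lia.
  by rewrite -exprD ler_weXn2l // ltW.
rewrite !mulrDr; apply: lerD; first by rewrite -exprSr -exprD.
have -> : q ^+ N.+1 * (2 ^+ N./2 * (X * q ^ (Q0%:Z - N./2%:Z)))
   + q ^+ N.+1 * (2 ^+ N./2 * (X * (s%:R * q ^ (Q0%:Z - N%:Z))))
   = 2 ^+ N./2 * (X * (q ^+ N.+1 * q ^ (Q0%:Z - N./2%:Z))
     + X * (s%:R * (q ^+ N.+1 * q ^ (Q0%:Z - N%:Z)))) by ring.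
have -> : q ^+ 2 * (q ^+ Q0 * X * 2 `^ (N%:R / 2) * q `^ (N%:R / 2))
   + q ^+ 2 * (q ^+ Q0 * X * 2 `^ (N%:R / 2) * s%:R)
   = 2 `^ (N%:R / 2) * (X * (q ^+ 2 * q ^+ Q0 * q `^ (N%:R / 2))
     + X * (s%:R * (q ^+ 2 * q ^+ Q0))) by ring.
have pos e : 0 <= q ^+ N.+1 * q ^ e by rewrite mulr_ge0 ?exprn_ge0 ?exprz_ge0 // ltW.
apply: ler_pM => //; first by rewrite exprn_ge0.
  by apply: addr_ge0; apply: mulr_ge0 => //; apply: mulr_ge0.
by apply: lerD; apply: ler_wpM2l => //; apply: ler_wpM2l.
Qed.

End SieveBound.

(** * Parseval applied to the fractions r/f *)

Section FareyFractions.
Variables (R : realType) (F : finFieldType).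
Implicit Types f r : {poly F}.

Lemma sum_deg_le (V : nmodType) (N : nat) (G : {poly F} -> V) :
  \sum_(g \in @deg_le F N) G g = \sum_(u : 'rV[F]_N.+1) G (rVpoly u).
Proof.
rewrite fsbig_finite /=; last exact: finite_deg_le.
rewrite -[RHS]big_enum -[RHS](big_map rVpoly xpredT G); apply: perm_big.
apply: uniq_perm; first exact: fset_uniq.
  by rewrite map_inj_uniq ?enum_uniq //; apply: can_inj rVpolyK.
move=> g; rewrite in_fset_set; last exact: finite_deg_le.
apply/idP/mapP => [/set_mem gN|[u _ ->]].
  by exists (poly_rV g); rewrite ?mem_enum ?poly_rV_K.
by apply/mem_set; apply: size_poly.
Qed.

Definition frac_row (N : nat) (fr : {poly F} * {poly F}) : 'rV[F]_N.+1 :=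
  \row_i (lpoly fr.2 / lpoly fr.1) (- 1 - i%:Z).

(** The coefficient of t^-1 in g r/f pairs the coefficient of t^i in g with that of t^(-1-i) in
    r/f. *)
Lemma echar_frac (N : nat) (u : 'rV[F]_N.+1) f r :
  echar R (lpoly (rVpoly u) * (lpoly r / lpoly f))
  = addchar R (\sum_i u 0 i * frac_row N (f, r) 0 i).
Proof.
have su : (size (rVpoly u) <= N.+1)%N by apply: size_poly.
rewrite /echar -/(addchar R _) (coef_lpolyM _ _ su).
by congr (addchar R _); apply: eq_bigr => i _; rewrite coef_rVpoly_ord mxE.
Qed.

Lemma bounded_by_frac (f r : {poly F}) : f != 0 -> (size r < size f)%N ->
  bounded_by (lpoly r / lpoly f) (- 1).
Proof.
move=> f0 rf.
have := bounded_by_div (is_ldeg_poly f0) (@bounded_by_poly F r).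
apply: bounded_by_le; move: rf; case: (size f) => [//|u].
by set v := size r; clearbody v; clear; lia.
Qed.

(** Proper fractions have no terms of degree 0 or more, and equal rows cancel those of degree -1
    down to -(N+1). *)
Lemma frac_row_near (N : nat) f r (f' r' : {poly F}) :
  f != 0 -> (size r < size f)%N -> f' != 0 -> (size r' < size f')%N ->
  frac_row N (f, r) = frac_row N (f', r') ->
  bounded_by (lpoly r / lpoly f - lpoly r' / lpoly f') (- N%:Z - 2).
Proof.
move=> f0 rf f0' rf' E i iN.
have b := bounded_by_frac f0 rf; have b' := bounded_by_frac f0' rf'.
transitivity ((lpoly r / lpoly f) i - (lpoly r' / lpoly f') i); first by [].
have [i1|i1] := ltP (- 1) i; first by rewrite b // b' // subrr.
have jN : (absz (- 1 - i)%R < N.+1)%N by lia.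
have := congr1 (fun v : 'rV_N.+1 => v 0 (Ordinal jN)) E; rewrite !mxE /=.
have -> : - 1 - (absz (- 1 - i)%R)%:Z = i by lia.
by move=> ->; rewrite subrr.
Qed.

Lemma finite_reduced_residues (f : {poly F}) : finite_set (reduced_residues f).
Proof.
apply: sub_finite_set (finite_deg_le F (size f)) => r [rf _].
by apply: leqW; apply: ltnW.
Qed.

(** The inner sum depends only on the row of r/f. Grouping by rows costs a factor K; the sum then
    extends to all rows, where Parseval is exact. *)
Lemma large_sieve_of_count (N : nat) (A : seq ({poly F} * {poly F})) (K : R)
    (a : {poly F} -> R[i]) :
  (forall v, (count (fun fr => frac_row N fr == v) A)%:R <= K) ->
  \sum_(fr <- A) ComplexField.Normc.normc
     (\sum_(g \in @deg_le F N) a g * echar R (lpoly g * (lpoly fr.2 / lpoly fr.1))) ^+ 2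
  <= #|F|%:R ^+ N.+1 * K * \sum_(g \in @deg_le F N) ComplexField.Normc.normc (a g) ^+ 2.
Proof.
move=> AK; rewrite sum_deg_le.
pose W (v : 'rV[F]_N.+1) : R := ComplexField.Normc.normc
  (\sum_(u : 'rV[F]_N.+1) a (rVpoly u) * addchar R (\sum_i u 0 i * v 0 i)) ^+ 2.
rewrite (eq_bigr (fun fr => W (frac_row N fr))); last first.
  move=> [f r] _; rewrite sum_deg_le /W; congr (ComplexField.Normc.normc _ ^+ 2).
  by apply: eq_bigr => u _; rewrite echar_frac.
rewrite (partition_big (frac_row N) xpredT) //=.
apply: le_trans (_ : \sum_v K * W v <= _).
  apply: ler_sum => v _.
  rewrite (eq_bigr (fun=> W v)) => [|fr /eqP -> //].
  rewrite big_const_seq iter_addr_0 -(mulr_natl (W v)).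
  by apply: ler_wpM2r (AK v); apply: sqr_ge0.
rewrite -mulr_sumr /W (parseval (fun u => a (rVpoly u))) natrX.
by rewrite mulrA (mulrC K).
Qed.

End FareyFractions.

Theorem theorem10p5 (R : realType) (q : nat)
  (q_prime_power : exists p n : nat, [/\ prime p, (0 < n)%N & q = (p ^ n)%N])
  (q_odd : odd q) :
  exists C : R,
  forall (F : finFieldType) (N Q0 : nat) (S : set {poly F}) (X : R),
  #|F| = q ->
  (forall f : {poly F}, S f -> f != 0 /\ (size f <= Q0.+1)%N) ->
  1 <= X ->
  (forall (h : {poly F}) (m : int) (k l : {poly F}),
     h != 0 ->
     0 <= m -> m <= Q0%:Z - (size h).-1%:Z ->
     k != 0 -> linf_norm R (lpoly k) <= (q%:R ^- N) `^ (- (1 / 2)) ->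
     coprimep k l ->
     (Amax R S Q0 h m k l)%:R
     <= (1 + ((ncard (Sdiv S h))%:R / linf_norm R (lpoly k))
             / (q%:R ^+ Q0 / linf_norm R (lpoly h)) * q%:R ^ m) * X) ->
  forall a : {poly F} -> R[i],
  \sum_(f \in S) \sum_(r \in reduced_residues f)
     ComplexField.Normc.normc
       (\sum_(g \in deg_le N)
           a g * echar R (lpoly g * (lpoly r / lpoly f))) ^+ 2
  <= C * (q%:R ^+ N
          + q%:R ^+ Q0 * X * 2 `^ (N%:R / 2)
            * (q%:R `^ (N%:R / 2) + (ncard S)%:R))
       * \sum_(g \in deg_le N) ComplexField.Normc.normc (a g) ^+ 2.
Proof.
exists (q%:R ^+ 2) => F N Q0 S X Fq S_deg X1 equi a.
have q1 : 1 < q%:R :> R by rewrite -Fq finField_gt1.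
have X0 : 0 <= X by apply: le_trans X1.
have equi' (h : {poly F}) (m : int) (k l : {poly F}) :
    h != 0 -> 0 <= m -> m <= Q0%:Z - (size h).-1%:Z ->
    k != 0 -> (size k <= N./2.+1)%N -> coprimep k l ->
    (Amax R S Q0 h m k l)%:R
    <= (1 + ((ncard (Sdiv S h))%:R / linf_norm R (lpoly k))
            / (#|F|%:R ^+ Q0 / linf_norm R (lpoly h)) * #|F|%:R ^ m) * X.
  move=> h0 m0 mQ k0 kN kl; rewrite Fq; apply: equi => //.
  (* deg k <= [N./2] gives |k| <= q^(N/2), which is the stated power of q^-N. *)
  rewrite linf_norm_poly // Fq powR_half_norm //; apply: exprn_le_powR => //.
  apply: le_trans (half_le R N); rewrite ler_nat.
  by move: kN; set u := size k; case: u.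
have finS := finite_S S_deg.
rewrite fsbig_finite //=.
under eq_bigr => f _ do rewrite (fsbig_finite _ _ (finite_reduced_residues f)) /=.
pose A := [seq (f, r) | f <- fset_set S, r <- fset_set (reduced_residues f)].
have uA : uniq A.
  apply: allpairs_uniq_dep; first exact: fset_uniq.
    by move=> f _; apply: fset_uniq.
  by move=> [f r] [f' r'] _ _ [-> ->].
have AP f r : (f, r) \in A ->
    [/\ S f, f != 0, (size r < size f)%N & coprimep r f].
  move=> /allpairsPdep[f' [r' [f'S r'f' [-> ->]]]].
  move: f'S r'f'; rewrite !in_fset_set //; last exact: finite_reduced_residues.
  by move=> /set_mem Sf /set_mem[rf cop]; have [f0 _] := S_deg _ Sf.
apply: le_trans (_ : \sum_(fr <- A) ComplexField.Normc.normc
       (\sum_(g \in @deg_le F N)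
           a g * echar R (lpoly g * (lpoly fr.2 / lpoly fr.1))) ^+ 2 <= _).
  by rewrite big_allpairs_dep.
apply: le_trans (large_sieve_of_count (K := #|F|%:R + 2 ^+ N./2 *
    (X * (#|F|%:R ^ (Q0%:Z - N./2%:Z) + (ncard S)%:R * #|F|%:R ^ (Q0%:Z - N%:Z)))) _ _) _.
  move=> v; rewrite -size_filter; set B := filter _ A.
  case EB : B => [|[f0 r0] B'].
    by rewrite addr_ge0 // !mulr_ge0 ?addr_ge0 ?mulr_ge0 ?exprn_ge0 ?exprz_ge0.
  (* Any fraction of a nonempty class can serve as alpha: the others agree with it to within
     q^(-N-2). *)
  have : (f0, r0) \in B by rewrite EB inE eqxx.
  rewrite -EB mem_filter => /andP[/eqP v0 /AP[_ f00 rf0 _]].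
  apply: (count_near S_deg X1 equi' (alpha := lpoly r0 / lpoly f0)).
    by rewrite filter_uniq.
  move=> f r; rewrite mem_filter => /andP[/eqP vE /AP[Sf f_0 rf cop]].
  by split => //; apply: frac_row_near; rewrite // vE v0.
apply: ler_wpM2r; last by rewrite Fq; apply: sieve_bound_le.
by rewrite sum_deg_le; apply: sumr_ge0 => u _; apply: sqr_ge0.
Qed.
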